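(* For every odd integer $n \ge 5$, the equality $\chi_{la}(C_n \circ \overline{K_m}) = mn+3$ holds for all but finitely many positive integers $m$, where $C_n$ is the cycle on $n$ vertices.
   Context: Let $G=(V,E)$ be a finite simple undirected graph with no component isomorphic to $K_2$. A bijection $f : E \to \{1,2,\dots,|E|\}$ is a local antimagic labeling of $G$ if $w(u)\ne w(v)$ for every pair of adjacent vertices $u,v$, where $w(u)=\sum_{e\in E(u)} f(e)$ and $E(u)$ is the set of edges incident to $u$. Such an $f$ induces the proper vertex coloring $v\mapsto w(v)$, which uses $|\{w(v): v\in V\}|$ colors. The local antimagic chromatic number $\chi_{la}(G)$ is the minimum number of colors used over all colorings induced by local antimagic labelings of $G$ (so $\chi_{la}(G)\le k$ means that there is a local antimagic labeling inducing at most $k$ colors). The corona product $G\circ H$ is obtained from one copy of $G$ and $|V(G)|$ copies of $H$ by joining the $i$-th vertex of $G$ to every vertex of the $i$-th copy of $H$, for $1\le i\le |V(G)|$. $\overline{K_m}$ is the null (edgeless) graph on $m$ vertices. *)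

(* Defs.v *)
From mathcomp Require Import all_boot.

Set Implicit Arguments.
Unset Strict Implicit.
Unset Printing Implicit Defensive.

Record sgraph := SGraph {
  vertex :> finType;
  adj : rel vertex;
  adj_sym : symmetric adj;
  adj_irr : irreflexive adj }.

Definition edges (G : sgraph) : {set {set G}} :=
  [set e : {set G} | [exists u, exists v, adj u v && (e == [set u; v])]].

Definition weight (G : sgraph) (f : {set G} -> nat) (v : G) : nat :=
  \sum_(e in edges G | v \in e) f e.

(* Labelings are functions on all vertex sets; only their values on [edges G]
   matter. *)
Definition edge_bijection (G : sgraph) (f : {set G} -> nat) : Prop :=
  [/\ {in edges G &, injective f},
      forall e, e \in edges G -> 1 <= f e <= #|edges G|
    & forall k, 1 <= k <= #|edges G| -> exists2 e, e \in edges G & f e = k].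

Definition local_antimagic (G : sgraph) (f : {set G} -> nat) : Prop :=
  edge_bijection f /\ forall u v : G, adj u v -> weight f u <> weight f v.

Definition num_colors (G : sgraph) (f : {set G} -> nat) : nat :=
  size (undup [seq weight f v | v : G]).

(* A relation rather than a function: no value is assigned to a graph without
   local antimagic labelings. *)
Definition is_chi_la (G : sgraph) (k : nat) : Prop :=
  (exists2 f : {set G} -> nat, local_antimagic f & num_colors f = k) /\
  (forall f : {set G} -> nat, local_antimagic f -> k <= num_colors f).

Lemma is_chi_la_unique (G : sgraph) (k l : nat) :
  is_chi_la G k -> is_chi_la G l -> k = l.
Proof.
move=> [[f lf <-] kmin] [[g lg <-] lmin].
by apply/eqP; rewrite eqn_leq kmin // lmin.
Qed.

Section Corona.
Variables G H : sgraph.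

(* [inr (u, x)] is the vertex [x] of the copy of [H] attached to [u]. *)
Definition corona_adj (a b : G + G * H) : bool :=
  match a, b with
  | inl u, inl v => adj u v
  | inl u, inr (v, _) => u == v
  | inr (u, _), inl v => u == v
  | inr (u, x), inr (v, y) => (u == v) && adj x y
  end.

Lemma corona_adj_sym : symmetric corona_adj.
Proof.
by move=> [u|[u x]] [v|[v y]] /=; rewrite ?[v == u]eq_sym // adj_sym.
Qed.

Lemma corona_adj_irr : irreflexive corona_adj.
Proof. by move=> [u|[u x]] /=; rewrite adj_irr ?andbF. Qed.

Definition corona : sgraph := SGraph corona_adj_sym corona_adj_irr.

End Corona.

Section Cycle.
Variable n : nat.

(* The disequality only matters for [n = 1]; this is the cycle on [n] vertices
   when [3 <= n]. *)
Definition cycle_adj (i j : 'I_n) : bool :=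
  (i != j) && ((j == i.+1 %% n :> nat) || (i == j.+1 %% n :> nat)).

Lemma cycle_adj_sym : symmetric cycle_adj.
Proof. by move=> i j; rewrite /cycle_adj eq_sym orbC. Qed.

Lemma cycle_adj_irr : irreflexive cycle_adj.
Proof. by move=> i; rewrite /cycle_adj eqxx. Qed.

Definition cycle_graph : sgraph := SGraph cycle_adj_sym cycle_adj_irr.

End Cycle.

Section Null.
Variable m : nat.

Definition null_adj (i j : 'I_m) : bool := false.

Lemma null_adj_sym : symmetric null_adj.
Proof. by []. Qed.

Lemma null_adj_irr : irreflexive null_adj.
Proof. by []. Qed.

Definition null_graph : sgraph := SGraph null_adj_sym null_adj_irr.

End Null.

(* Main.v *)
(* Once m >= 2n + 2, a cycle vertex has weight at least the sum of m distinct
   positive labels, which exceeds the number n(m+1) of edges; so its color is none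
   of the mn distinct colors of the pendant vertices, and the odd cycle itself
   needs three colors. For the converse, the cycle edges get the labels
   1, n, 2, n-1, ..., (n+1)/2, whose consecutive sums alternate between n+1 and
   n+2 except for the closing one, (n+3)/2. The remaining labels form m blocks of
   n consecutive integers; permuting each block suitably (a Kotzig array), every
   cycle vertex receives one label from each block with a sum independent of the
   vertex. *)
Require Import Defs.
From mathcomp Require Import all_boot.
From mathcomp Require Import zify.

Set Implicit Arguments.
Unset Strict Implicit.
Unset Printing Implicit Defensive.

(** * Sums of distinct naturals, Kotzig arrays, colorings of odd cycles *)

Lemma exists_leq_uniq (k : nat) (s : seq nat) :
  uniq s -> k < size s -> exists2 x, x \in s & k <= x.
Proof.
move=> us ks; apply/hasP; apply: contraLR ks => /hasPn s_lt.
rewrite -leqNgt -(size_iota 0 k) uniq_leq_size // => x /s_lt.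
by rewrite mem_iota add0n -ltnNge.
Qed.

(** The extremal case is [0, 1, ..., k]; by pigeonhole some entry is at least [k], and removing it
    leaves [k] distinct entries for the induction. *)
Lemma bin2_leq_sum (s : seq nat) : uniq s -> 'C(size s, 2) <= \sum_(x <- s) x.
Proof.
elim: {s}(size s) {-2}s (erefl (size s)) => [|k IHk] s sz us; first by rewrite (size0nil sz) bin0n.
rewrite sz; have [x xs kx] := exists_leq_uniq us (eq_leq (esym sz)).
rewrite (perm_big _ (perm_to_rem xs)) big_cons binS bin1 addnC leq_add //.
have szr : size (rem x s) = k by rewrite size_rem // sz.
by rewrite -szr IHk ?rem_uniq.
Qed.

(* For m = 3 and n = 2k + 1, the sums i + r i run through all of [k, 3k]. *)
Lemma kotzig_array (n m : nat) : odd n -> m != 1 ->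
  exists (p : nat -> nat -> nat) (s : nat),
  [/\ forall j i, i < n -> p j i < n,
      forall j i i', i < n -> i' < n -> p j i = p j i' -> i = i'
    & forall i, i < n -> \sum_(j < m) p j i = s].
Proof.
move=> n_odd; elim/ltn_ind: m => -[|[|[|[|m]]]] IHm // _.
- by exists (fun _ i => i), 0; split=> // i _; rewrite big_ord0.
- exists (fun j i => if j == 0 then i else n.-1 - i), n.-1.
  split=> [[|j] i|[|j] i i'|i] /=; rewrite ?big_ord_recl ?big_ord0 /=; lia.
- pose k := n./2; have nE : n = k.*2.+1 by rewrite /k; lia.
  pose r i := if i <= k then i + k else i - k.+1.
  exists (fun j i => if j == 0 then i else if j == 1 then r i else 3 * k - (i + r i)).
  exists (3 * k); rewrite /r.
  split=> [[|[|j]] i|[|[|j]] i i'|i] /=; rewrite ?big_ord_recl ?big_ord0 /=;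
    by do ?[case: ifP]; lia.
(* Append two rows, the identity and its reversal, which add [n.-1] to every column sum. *)
have [||p [s [p_lt p_inj p_sum]]] := IHm m.+2; [lia| lia|].
exists (fun j i => if j < m.+2 then p j i else if j == m.+2 then i else n.-1 - i).
exists (s + n.-1); split=> [j i i_lt|j i i' i_lt i'_lt|i i_lt].
- by case: ifP => _; [apply: p_lt|case: ifP => _; lia].
- by case: ifP => _; [apply: p_inj|case: ifP => _; lia].
rewrite big_ord_recr big_ord_recr /= !ltnn ltnNge leqnSn /= eqxx.
rewrite (eqn_leq m.+3) ltnn /= -addnA subnKC; last by lia.
congr (_ + _); rewrite -(p_sum i i_lt); apply: eq_bigr => j _.
by rewrite ltn_ord.
Qed.

Lemma val_iter_ordS (n k : nat) (i : 'I_n) : iter k (@ordS n) i = (i + k) %% n :> nat.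
Proof.
elim: k => [|k IHk] /=; first by rewrite addn0 modn_small.
by rewrite IHk addnS -[in LHS]addn1 modnDml addn1.
Qed.

(** Otherwise [w] is invariant under double steps, and an even number of steps leads from
    [ordS ord0] around the odd cycle to [ord0]. *)
Lemma odd_cycle_three_colors (n : nat) (T : eqType) (w : 'I_n -> T) : odd n ->
  (forall i, w i != w (ordS i)) ->
  exists i, uniq [:: w i; w (ordS i); w (ordS (ordS i))].
Proof.
case: n w => // n w /= n_even w_neq.
have [/existsP[i wi]|] := boolP [exists i, w i != w (ordS (ordS i))].
  by exists i; rewrite /= !inE !w_neq negb_or wi w_neq.
rewrite negb_exists => /forallP w_per.
have iterw k i : w (iter k.*2 (@ordS _) i) = w i.
  by elim: k => //= k <-; apply/esym/eqP/negPn.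
case/eqP: (w_neq ord0); rewrite -(iterw n./2 (ordS ord0)) -iterSr even_halfK //.
by congr w; apply: ord_inj; rewrite val_iter_ordS add0n modnn.
Qed.

(** * Edges, weights and color counts of the corona *)

Section CoronaCycle.
Variables n m : nat.
Hypothesis n_ge3 : 2 < n.
Local Notation G := (corona (cycle_graph n) (null_graph m)).

(* Edges are indexed by the vertices: [inl i] stands for the cycle edge leaving
   [i], and [inr p] for the edge joining the pendant vertex [p] to the cycle. *)
Definition corona_edge (t : 'I_n + 'I_n * 'I_m) : {set G} :=
  match t with
  | inl i => [set inl i; inl (ordS i)]
  | inr p => [set inl p.1; inr p]
  end.

Lemma ordS_neq (i : 'I_n) : ordS i != i.
Proof.
apply/eqP => /(congr1 val) /=.
case: (ltnP i.+1 n) => [lt_in|]; first by rewrite modn_small; lia.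
have i_lt := ltn_ord i; move=> n_le.
by rewrite (_ : i.+1 = n) ?modnn; lia.
Qed.

Lemma ordS2_neq (i : 'I_n) : ordS (ordS i) != i.
Proof.
have iE : ordS (ordS i) = (i + 2) %% n :> nat := val_iter_ordS 2 i.
apply/eqP => iI; move: iE; rewrite iI.
have i_lt := ltn_ord i; case: (ltnP (i + 2) n) => h.
  by rewrite modn_small //; lia.
rewrite -(subnK h) modnDr modn_small; lia.
Qed.

Lemma corona_edge_inj : injective corona_edge.
Proof.
have inlI (a b : 'I_n) : (inl a : G) == inl b -> a = b by move/eqP=> [].
move=> [i|p] [j|q] /setP eE.
- have := eE (inl i); have := eE (inl (ordS i)).
  rewrite !inE !eqxx orbT /= => /esym SiE /esym/orP[] /inlI; first by move=> ->.
  (* The two cycle edges would overlap crosswise, [i = ordS j], so that [ordS (ordS j)] is [j] or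
     [ordS j]: impossible on a cycle of length at least 3. *)
  move=> iE; move: SiE; rewrite iE.
  by case/orP=> /inlI/eqP; rewrite ?(negPf (ordS2_neq _)) ?(negPf (ordS_neq _)).
- by have := eE (inr q); rewrite !inE eqxx.
- by have := eE (inr p); rewrite !inE eqxx.
by have := eE (inr p); rewrite !inE eqxx orbT => /esym/eqP[->].
Qed.

Lemma adj_ordS (i : 'I_n) : @adj (cycle_graph n) i (ordS i).
Proof. by rewrite /= /cycle_adj eq_sym ordS_neq /= eqxx. Qed.

Lemma edges_coronaE : edges G = [set corona_edge t | t : 'I_n + 'I_n * 'I_m].
Proof.
apply/setP=> e; rewrite inE; apply/existsP/imsetP => [[u /existsP[v]]|[[i|[i j]] _ ->]].
- case/andP=> uv /eqP->; case: u v uv => [i|[i x]] [j|[j y]] //=; last by rewrite andbF.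
  + case/andP=> _ /orP[] /eqP h.
      by exists (inl i) => //=; congr [set _; inl _]; apply: val_inj.
    by exists (inl j) => //=; rewrite setUC; congr [set _; inl _]; apply: val_inj.
  + by move/eqP->; exists (inr (j, y)).
  + by move/eqP->; exists (inr (j, x)); rewrite // setUC.
- by exists (inl i); apply/existsP; exists (inl (ordS i)); rewrite eqxx andbT; apply: adj_ordS.
by exists (inl i); apply/existsP; exists (inr (i, j)); rewrite /= !eqxx.
Qed.

Lemma card_edges_corona : #|edges G| = n * m.+1.
Proof.
rewrite edges_coronaE card_imset; last exact: corona_edge_inj.
by rewrite card_sum card_prod !card_ord mulnS.
Qed.

Lemma corona_edge_in t : corona_edge t \in edges G.
Proof. by rewrite edges_coronaE imset_f. Qed.

Lemma corona_weightE (f : {set G} -> nat) (v : G) :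
  weight f v = \sum_(t | v \in corona_edge t) f (corona_edge t).
Proof.
rewrite /weight edges_coronaE big_mkcondr big_imset /=; last first.
  by move=> ? ? _ _; apply: corona_edge_inj.
by rewrite -big_mkcondr; apply: eq_bigl => t; rewrite inE.
Qed.

Lemma weight_pendant (f : {set G} -> nat) p :
  weight f (inr p : G) = f (corona_edge (inr p)).
Proof.
rewrite corona_weightE (big_pred1 (inr p)) // => -[i|q] /=; rewrite !inE //=.
Qed.

Lemma weight_cycle (f : {set G} -> nat) (i : 'I_n) :
  weight f (inl i : G) =
  f (corona_edge (inl i)) + f (corona_edge (inl (ord_pred i)))
  + \sum_(j < m) f (corona_edge (inr (i, j))).
Proof.
rewrite corona_weightE big_sumType /=; congr (_ + _).
  rewrite (bigD1 i) ?inE ?eqxx //; congr (_ + _).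
  rewrite (big_pred1 (ord_pred i)) // => k; rewrite !inE.
  have -> : (k == ord_pred i) = (i == ordS k).
    by apply/eqP/eqP => [->|->]; rewrite ?ord_predK ?ordSK.
  rewrite !(inj_eq (@inl_inj _ _)) eq_sym.
  by case: (k =P i) => [->|]; rewrite ?andbF ?andbT // eq_sym (negPf (ordS_neq i)).
(* The sum over [j] becomes a double sum restricted to [k == i], to match the sum over pendant
   edges. *)
rewrite -(big_pred1_eq addn i (fun k => \sum_(j < m) f (corona_edge (inr (k, j))))).
rewrite pair_big /=; apply: eq_big => [[k j]|[k j] _] //=.
by rewrite !inE orbF andbT eq_sym.
Qed.

(** Surjectivity is automatic: there are exactly [n * m.+1] indices, as many as admissible
    labels. *)
Lemma labeling_of_index (L : 'I_n + 'I_n * 'I_m -> nat) : injective L ->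
  (forall t, 1 <= L t <= n * m.+1) ->
  exists2 f : {set G} -> nat, edge_bijection f & forall t, f (corona_edge t) = L t.
Proof.
move=> L_inj L_bnd.
exists (fun e => if [pick t | corona_edge t == e] is Some t then L t else 0); last first.
  by move=> t; case: pickP => [t' /eqP/corona_edge_inj->//|/(_ t)]; rewrite eqxx.
set f := fun e => _.
have fE t : f (corona_edge t) = L t.
  by rewrite /f; case: pickP => [t' /eqP/corona_edge_inj->//|/(_ t)]; rewrite eqxx.
split; rewrite ?card_edges_corona ?edges_coronaE.
- by move=> _ _ /imsetP[t _ ->] /imsetP[u _ ->]; rewrite !fE => /L_inj->.
- by move=> _ /imsetP[t _ ->]; rewrite fE.
move=> k k_bnd; have : k \in codom L.
  have L_iota : {subset codom L <= iota 1 (n * m.+1)}.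
    by move=> _ /codomP[t ->]; rewrite mem_iota add1n ltnS.
  have [||_ ->] := uniq_min_size _ L_iota.
  - by rewrite map_inj_uniq ?enum_uniq.
  - by rewrite size_iota size_codom card_sum card_prod !card_ord mulnS.
  by rewrite mem_iota add1n ltnS.
by case/codomP=> t ->; exists (corona_edge t); rewrite ?imset_f.
Qed.

Lemma num_colors_corona_ge (f : {set G} -> nat) : odd n -> n.*2.+1 < m ->
  local_antimagic f -> m * n + 3 <= num_colors f.
Proof.
move=> n_odd m_gt [[f_inj f_bnd f_onto] f_adj].
have [i ui] : exists i : 'I_n, uniq [:: weight f (inl i : G);
    weight f (inl (ordS i) : G); weight f (inl (ordS (ordS i)) : G)].
  apply: (@odd_cycle_three_colors n _ (fun i => weight f (inl i : G))) => // i.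
  by apply/eqP/f_adj; apply: adj_ordS.
have fE_inj : injective (f \o corona_edge).
  by move=> t u /= /f_inj h; apply: corona_edge_inj; apply: h; apply: corona_edge_in.
have w_gt k : n * m.+1 < weight f (inl k : G).
  have h : 'C(m, 2) <= \sum_(j < m) f (corona_edge (inr (k, j))).
    have /bin2_leq_sum : uniq [seq f (corona_edge (inr (k, j))) | j : 'I_m].
      rewrite map_inj_uniq ?enum_uniq //.
      by move=> j j' /(@fE_inj (inr _) (inr _))[].
    by rewrite big_image size_map -cardE card_ord.
  rewrite weight_cycle; rewrite bin2 in h.
  have /andP[h1 _] := f_bnd _ (corona_edge_in (inl k)).
  (* This is where [m >= 2n + 2] enters. [bin2_leq_sum] gives only a weak bound here; the positive
     label in [h1] makes the final inequality strict. *)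
  have h2 : n.*2 * m.+1 <= m * m.-1.
    by rewrite -(subnKC m_gt); move: (m - _) => d; nia.
  have h3 : n * m.+1 <= (m * m.-1)./2.
    by rewrite -(doubleK (n * _)) doubleMl half_leq.
  by rewrite addnAC ltn_addr //; apply: leq_add h1 (leq_trans h3 h).
pose s := [seq weight f (inr p : G) | p : 'I_n * 'I_m].
pose c := [:: weight f (inl i : G);
    weight f (inl (ordS i) : G); weight f (inl (ordS (ordS i)) : G)].
have size_sc : size (s ++ c) = m * n + 3.
  by rewrite size_cat size_map -cardE card_prod !card_ord mulnC.
rewrite -size_sc uniq_leq_size //.
  rewrite cat_uniq ui andbT map_inj_uniq ?enum_uniq; last first.
    by move=> p q; rewrite !weight_pendant => /(@fE_inj (inr _) (inr _))[].
  apply/hasPn=> x xc; apply/negP=> /mapP[p _ xE].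
  have : x <= n * m.+1.
    rewrite xE weight_pendant -card_edges_corona.
    by case/andP: (f_bnd _ (corona_edge_in (inr p))).
  by move: xc; rewrite !inE leqNgt => /or3P[]/eqP->; rewrite w_gt.
move=> x; rewrite mem_cat mem_undup => /orP[/mapP[p _ ->]|]; first exact: image_f.
by rewrite !inE => /or3P[]/eqP->; apply: image_f.
Qed.

Lemma corona_labeling : odd n -> 1 < m ->
  exists2 f : {set G} -> nat, local_antimagic f & num_colors f <= m * n + 3.
Proof.
move=> n_odd m_gt1.
have [|p [s [p_lt p_inj p_sum]]] := @kotzig_array n m n_odd; first by lia.
pose a i := if odd i then n - i./2 else i./2.+1.
(* Labels [1..n] go to the cycle; row [j] of the array permutes the block from [j.+1 * n + 1] to
   [j.+2 * n]. *)
pose L (t : 'I_n + 'I_n * 'I_m) :=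
  match t with inl i => a i | inr (i, j) => j.+1 * n + (p j i).+1 end.
have a_bnd i : i < n -> 1 <= a i <= n by rewrite /a; case: ifP; lia.
have [||f f_bij fE] := @labeling_of_index L.
- move=> [i|[i j]] [i'|[i' j']] /=.
  + move=> h; congr inl; apply: val_inj => /=; move: h.
    by have := ltn_ord i; have := ltn_ord i'; rewrite /a; do 2 case: ifP; lia.
  + by have := a_bnd _ (ltn_ord i); nia.
  + by have := a_bnd _ (ltn_ord i'); nia.
  have pi := p_lt j i (ltn_ord i); have pi' := p_lt j' i' (ltn_ord i').
  move=> h; have jj' : j = j' by apply: val_inj => /=; nia.
  move: h; rewrite -jj' => /addnI[] /p_inj h; congr (inr (_, _)).
  by apply: val_inj; apply: h.
- move=> [i|[i j]] /=; first by have := a_bnd _ (ltn_ord i); nia.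
  by have := p_lt j i (ltn_ord i); have := ltn_ord j; nia.
(* [r] is the pendant contribution common to all cycle vertices; [c i] is that of the two cycle
   edges at [i], where [i = 0] meets the closing edge. *)
pose r := \sum_(j < m) (j.+1 * n).+1 + s.
pose c (i : nat) := if i == 0 then n./2 + 2 else if odd i then n + 1 else n + 2.
have w_cycle (i : 'I_n) : weight f (inl i : G) = c i + r.
  rewrite weight_cycle !fE; congr (_ + _).
    rewrite /= /c; case: (i =P 0 :> nat) => [-> | ].
      by rewrite add0n modn_small /a /=; do ?[case: ifP]; lia.
    move=> i_gt0; rewrite (_ : (i + n).-1 = i.-1 + n); last by lia.
    have i_lt := ltn_ord i.
    by rewrite modnDr modn_small /a; do ?[case: ifP]; lia.
  rewrite /r -(p_sum i (ltn_ord i)) -big_split.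
  by apply: eq_bigr => j _; rewrite fE /= addnS addSn.
have w_pend q : weight f (inr q : G) = L (inr q) by rewrite weight_pendant fE.
(* The pendant label is one summand of the weight of its cycle neighbor, which also contains
   positive cycle labels. *)
have L_lt (i : 'I_n) (j : 'I_m) : weight f (inr (i, j) : G) < weight f (inl i : G).
  rewrite weight_cycle weight_pendant (bigD1 j) //= (fE (inl i)) /=.
  by have := a_bnd _ (ltn_ord i); lia.
exists f; first split=> //.
  have cS (i j : 'I_n) : j = i.+1 %% n :> nat -> c i <> c j.
    have i_lt := ltn_ord i; case: (ltnP i.+1 n) => h.
      by rewrite modn_small // => ->; rewrite /c; do ?[case: ifP]; lia.
    by rewrite (_ : i.+1 = n) ?modnn => [->|]; rewrite ?/c /=; do ?[case: ifP]; lia.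
  move=> [i|[i x]] [j|[j y]] //=.
  - case/andP=> _ /orP[]/eqP/cS h; rewrite !w_cycle => /addIn; first exact: h.
    by move/esym.
  - by move/eqP=> ->; apply/eqP; rewrite gtn_eqF ?L_lt.
  - by move/eqP=> <-; apply/eqP; rewrite ltn_eqF ?L_lt.
  by rewrite andbF.
(* All colors lie among the pendant labels [n + 1, ..., n + m * n] and the three values of
   [c i + r]. *)
pose l := iota n.+1 (m * n) ++ [:: n./2 + 2 + r; n + 1 + r; n + 2 + r].
rewrite (_ : m * n + 3 = size l); last by rewrite size_cat size_iota.
apply: uniq_leq_size (undup_uniq _) _ => x; rewrite mem_undup => /imageP[[i|[i j]] _ ->].
  by rewrite mem_cat w_cycle !inE /c; do 2?case: ifP; rewrite eqxx ?orbT.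
rewrite mem_cat w_pend /= mem_iota; apply/orP; left.
by have := p_lt j i (ltn_ord i); have := ltn_ord j; nia.
Qed.

End CoronaCycle.

Theorem theorem3p17 (n : nat) (n_odd : odd n) (n_ge5 : 5 <= n) :
  exists exceptions : seq nat, forall m : nat,
    0 < m -> m \notin exceptions ->
    is_chi_la (corona (cycle_graph n) (null_graph m)) (m * n + 3).
Proof.
(* The exceptions are [0, ..., 2n + 1], leaving [m >= 2n + 2] as the lower bound requires. *)
exists (iota 0 n.*2.+2) => m _; rewrite mem_iota add0n -leqNgt => m_gt.
have n_ge3 : 2 < n by lia.
have lower := num_colors_corona_ge n_ge3 n_odd m_gt.
split=> //; have [|f f_la f_le] := corona_labeling n_ge3 n_odd (_ : 1 < m).
  by lia.
by exists f => //; apply/eqP; rewrite eqn_leq f_le lower.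
Qed.
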